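(* Let $(X,r)$ be a solution of the YBE such that $\operatorname{Ret}(X,r)=(X,r)$. Then the left brace $\mathcal{G}(X,r)$ satisfies $\operatorname{Soc}(\mathcal{G}(X,r))=\{1\}$.
   Context: A solution of the YBE is a pair $(X,r)$ where $X$ is a non-empty set and $r\colon X\times X\to X\times X$, $r(x,y)=(\sigma_x(y),\gamma_y(x))$, satisfies: $r^2=\mathrm{id}$; $\sigma_x,\gamma_x\in\operatorname{Sym}(X)$ for all $x\in X$; and $r_{12}r_{23}r_{12}=r_{23}r_{12}r_{23}$ on $X^3$, where $r_{ij}$ acts as $r$ on the $(i,j)$ components and as the identity on the remaining one. Retraction: define $x\sim y$ iff $\sigma_x=\sigma_y$. $\operatorname{Ret}(X,r)$ is the induced solution on $X/{\sim}$, $\bar r(\bar x,\bar y)=(\overline{\sigma_x(y)},\overline{\gamma_y(x)})$. The condition $\operatorname{Ret}(X,r)=(X,r)$ (irretractability) means that $\sigma_x=\sigma_y$ implies $x=y$. A left brace is a set $B$ with operations $+$ and $\cdot$ such that $(B,+)$ is an abelian group, $(B,\cdot)$ is a group, and $a\cdot(b+c)+a=a\cdot b+a\cdot c$ for all $a,b,c\in B$. Put $\lambda_a(b)=a\cdot b-a$; then $a\mapsto\lambda_a$ is a homomorphism $(B,\cdot)\to\operatorname{Aut}(B,+)$. The socle is $\operatorname{Soc}(B)=\{a\in B\mid\lambda_a=\mathrm{id}_B\}$; it is an ideal of $B$, i.e. a normal subgroup of $(B,\cdot)$ invariant under all $\lambda_a$. The structure group $G(X,r)=\langle X\mid xy=zt\text{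 whenever }r(x,y)=(z,t)\rangle$ has a natural left brace structure, whose multiplicative group is $G(X,r)$, whose additive group is free abelian with basis $X$ (so $X\subseteq G(X,r)$), and with $\lambda_x(y)=\sigma_x(y)$ for $x,y\in X$. The permutation group $\mathcal{G}(X,r)$ is the subgroup of $\operatorname{Sym}(X)$ generated by $\{\sigma_x\mid x\in X\}$. The map $x\mapsto\sigma_x$ extends to a surjective group homomorphism $\phi\colon G(X,r)\to\mathcal{G}(X,r)$, where $\phi(g)$ is the restriction of $\lambda_g$ to $X$, with kernel $\operatorname{Soc}(G(X,r))$; the natural left brace structure on $\mathcal{G}(X,r)$ is the one induced from $\mathcal{G}(X,r)\cong G(X,r)/\operatorname{Soc}(G(X,r))$, so that $\phi$ is a homomorphism of left braces. *)

(* Defs.v *)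
From HB Require Import structures.
From mathcomp Require Import all_boot all_order all_algebra.
From mathcomp Require Import generic_quotient.
From mathcomp Require Import boolp classical_sets.
From mathcomp Require Import freeg.

Set Implicit Arguments.
Unset Strict Implicit.
Unset Printing Implicit Defensive.

Import GRing.Theory Num.Theory.
Local Open Scope quotient_scope.
Local Open Scope ring_scope.

HB.mixin Record Group_Zmodule_isLeftBrace B of Group B & GRing.Zmodule B := {
  braceMD : forall a b c : B, (a * (b + c))%g + a = (a * b)%g + (a * c)%g
}.

#[short(type="leftBraceType")]
HB.structure Definition LeftBrace :=
  {B of Group_Zmodule_isLeftBrace B & Group B & GRing.Zmodule B}.

Definition lambda (B : leftBraceType) (a b : B) : B := (a * b)%g - a.

Definition socle (B : leftBraceType) : set B :=
  [set a | lambda a = id]%classic.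
Arguments socle : clear implicits.

Section LeftBraceTheory.
Variable B : leftBraceType.
Implicit Types a b c : B.

Lemma braceM_lambda a b : (a * b)%g = a + lambda a b.
Proof. by rewrite /lambda addrC subrK. Qed.

Lemma lambdaD a b c : lambda a (b + c) = lambda a b + lambda a c.
Proof.
have e : (a * (b + c))%g = (a * b)%g + (a * c)%g - a.
  by apply: (addIr a); rewrite subrK braceMD.
by rewrite /lambda e -addrA addrACA.
Qed.

Lemma lambdaM a b c : lambda (a * b)%g c = lambda a (lambda b c).
Proof.
have e : (a * b * c)%g = (a * b)%g + ((a * lambda b c)%g - a).
  by apply: (addIr a); rewrite addrA subrK -braceMD -braceM_lambda mulgA.
by rewrite {1}/lambda e addrC addKr.
Qed.

Lemma lambda1 c : lambda 1%g c = c.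
Proof.
have h : lambda 1%g (lambda 1%g c) = lambda 1%g c by rewrite -lambdaM mulg1.
have e x : lambda (1%g : B) x = x - 1%g by rewrite /lambda mul1g.
by rewrite !e in h *; apply: (addIr (- (1%g : B))).
Qed.

Lemma lambdaVK a : cancel (lambda a) (lambda (a^-1)%g).
Proof. by move=> b; rewrite -lambdaM mulVg lambda1. Qed.

Lemma lambdaKV a : cancel (lambda (a^-1)%g) (lambda a).
Proof. by move=> b; rewrite -lambdaM mulgV lambda1. Qed.

Lemma braceD_lambda a b : a + b = (a * lambda (a^-1)%g b)%g.
Proof. by rewrite braceM_lambda lambdaKV. Qed.

End LeftBraceTheory.

Record sym (X : Type) := Sym {
  sym_fun :> X -> X;
  sym_inv : X -> X;
  sym_funK : cancel sym_fun sym_inv;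
  sym_invK : cancel sym_inv sym_fun
}.

Section SymGroup.
Variable X : Type.
Implicit Types f g h : sym X.

Lemma symP f g : (forall x, f x = g x) -> f = g.
Proof.
case: f g => [f f' fK f'K] [g g' gK g'K] /= /funext fg.
case: g / fg gK g'K => gK g'K.
have fg' : f' = g' by apply: funext => x; rewrite -{1}[x]g'K fK.
by case: g' / fg' gK g'K => gK g'K; congr Sym; exact: Prop_irrelevance.
Qed.

Lemma bijective_sym (u : X -> X) : bijective u -> {f : sym X | sym_fun f = u}.
Proof.
move=> bu; have /cid2 [v uK vK] : exists2 v, cancel u v & cancel v u.
  by case: bu => v; exists v.
by exists (Sym uK vK).
Qed.

Definition sym_of (u : X -> X) (bu : bijective u) : sym X :=
  projT1 (bijective_sym bu).

Lemma sym_ofE u (bu : bijective u) x : sym_of bu x = u x.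
Proof. by rewrite /sym_of; case: bijective_sym => f /= ->. Qed.

Definition sym1 : sym X := @Sym X id id (fun=> erefl) (fun=> erefl).
Definition symV f : sym X := Sym (@sym_invK _ f) (@sym_funK _ f).
(* composition of functions: [(f * g) x = f (g x)] *)
Definition symM f g : sym X :=
  Sym (can_comp (@sym_funK _ f) (@sym_funK _ g))
      (can_comp (@sym_invK _ g) (@sym_invK _ f)).

HB.instance Definition _ := gen_eqMixin (sym X).
HB.instance Definition _ := gen_choiceMixin (sym X).

Fact symMA : associative symM. Proof. by move=> f g h; exact: symP. Qed.
Fact sym1M : left_id sym1 symM. Proof. by move=> f; exact: symP. Qed.
Fact symM1 : right_id sym1 symM. Proof. by move=> f; exact: symP. Qed.
Fact symVM : left_inverse sym1 symV symM.
Proof. by move=> f; apply: symP => x /=; rewrite sym_funK. Qed.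
Fact symMV : right_inverse sym1 symV symM.
Proof. by move=> f; apply: symP => x /=; rewrite sym_invK. Qed.

HB.instance Definition _ := isGroup.Build (sym X) symMA sym1M symM1 symVM symMV.

Lemma sym1E x : (1%g : sym X) x = x. Proof. by []. Qed.
Lemma symME f g x : (f * g)%g x = f (g x). Proof. by []. Qed.
Lemma symKV f x : f ((f^-1)%g x) = x. Proof. exact: sym_invK. Qed.
Lemma symVK f x : (f^-1)%g (f x) = x. Proof. exact: sym_funK. Qed.

End SymGroup.

Definition ybe12 (X : Type) (r : X * X -> X * X) (t : X * X * X) : X * X * X :=
  (r t.1, t.2).

Definition ybe23 (X : Type) (r : X * X -> X * X) (t : X * X * X) : X * X * X :=
  let u := r (t.1.2, t.2) in (t.1.1, u.1, u.2).

Record ybe_solution := YbeSolution {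
  ybe_carrier :> Type;
  ybe_map : ybe_carrier * ybe_carrier -> ybe_carrier * ybe_carrier;
  ybe_inhabited : inhabited ybe_carrier;
  ybe_involutive : involutive ybe_map;
  ybe_sigma_bij : forall x, bijective (fun y => (ybe_map (x, y)).1);
  ybe_gamma_bij : forall y, bijective (fun x => (ybe_map (x, y)).2);
  ybe_braid : forall t,
    ybe12 ybe_map (ybe23 ybe_map (ybe12 ybe_map t)) =
    ybe23 ybe_map (ybe12 ybe_map (ybe23 ybe_map t))
}.

HB.instance Definition _ (S : ybe_solution) := gen_eqMixin (ybe_carrier S).
HB.instance Definition _ (S : ybe_solution) := gen_choiceMixin (ybe_carrier S).

Definition sigma (S : ybe_solution) (x : S) : sym S := sym_of (ybe_sigma_bij x).
Definition gamma (S : ybe_solution) (y : S) : sym S := sym_of (ybe_gamma_bij y).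

(* The retraction is the quotient of [S] by the relation
   [sigma x = sigma y]; it equals [S] when this relation is equality. *)
Definition irretractable (S : ybe_solution) : Prop :=
  forall x y : S, sigma x = sigma y -> x = y.

Section YbeTheory.
Variable S : ybe_solution.
Implicit Types x y z : S.

Lemma ybe_mapE x y : ybe_map (x, y) = (sigma x y, gamma y x).
Proof. by rewrite !sym_ofE -surjective_pairing. Qed.

Lemma ybe_sigmaK x y : sigma (sigma x y) (gamma y x) = x.
Proof. by have := ybe_involutive (x, y); rewrite !ybe_mapE => -[]. Qed.

Lemma ybe_gammaK x y : gamma (gamma y x) (sigma x y) = y.
Proof. by have := ybe_involutive (x, y); rewrite !ybe_mapE => -[]. Qed.

Lemma ybe_sigmaM x y :
  (sigma (sigma x y) * sigma (gamma y x) = sigma x * sigma y)%g.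
Proof.
apply: symP => z; rewrite !symME.
have := ybe_braid (x, y, z).
rewrite /ybe12 /ybe23 /=; do ![rewrite !ybe_mapE /=].
by case.
Qed.

End YbeTheory.

(* The group presented by the generators [x : S] and the relations [x y = z t]
   for [ybe_map (x, y) = (z, t)], as group expressions modulo the congruence
   generated by the group axioms and these relations. *)
Inductive sg_term (X : Type) : Type :=
  | SgOne
  | SgGen of X
  | SgMul of sg_term X & sg_term X
  | SgInv of sg_term X.
Arguments SgOne {X}.

HB.instance Definition _ (X : Type) := gen_eqMixin (sg_term X).
HB.instance Definition _ (X : Type) := gen_choiceMixin (sg_term X).

Inductive sg_equiv (S : ybe_solution) : sg_term S -> sg_term S -> Prop :=
  | SgRefl a : sg_equiv a a
  | SgSym a b : sg_equiv a b -> sg_equiv b a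
  | SgTrans b a c : sg_equiv a b -> sg_equiv b c -> sg_equiv a c
  | SgMulCongr a a' b b' :
      sg_equiv a a' -> sg_equiv b b' -> sg_equiv (SgMul a b) (SgMul a' b')
  | SgInvCongr a a' : sg_equiv a a' -> sg_equiv (SgInv a) (SgInv a')
  | SgMulA a b c : sg_equiv (SgMul a (SgMul b c)) (SgMul (SgMul a b) c)
  | SgMul1 a : sg_equiv (SgMul SgOne a) a
  | SgMulr1 a : sg_equiv (SgMul a SgOne) a
  | SgMulV a : sg_equiv (SgMul (SgInv a) a) SgOne
  | SgMulrV a : sg_equiv (SgMul a (SgInv a)) SgOne
  | SgRel x y z t : ybe_map (x, y) = (z, t) ->
      sg_equiv (SgMul (SgGen x) (SgGen y)) (SgMul (SgGen z) (SgGen t)).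

Section StructureGroup.
Variable S : ybe_solution.
Implicit Types x y z t : S.

Definition sg_equivb (a b : sg_term S) : bool := `[< sg_equiv a b >].

Fact sg_equivb_refl : reflexive sg_equivb.
Proof. by move=> a; apply/asboolP; exact: SgRefl. Qed.
Fact sg_equivb_sym : symmetric sg_equivb.
Proof. by move=> a b; apply/asboolP/asboolP => /SgSym. Qed.
Fact sg_equivb_trans : transitive sg_equivb.
Proof.
by move=> b a c /asboolP ab /asboolP bc; apply/asboolP; exact: SgTrans ab bc.
Qed.

Canonical sg_equiv_rel :=
  EquivRel sg_equivb sg_equivb_refl sg_equivb_sym sg_equivb_trans.

Definition structure_group := {eq_quot sg_equiv_rel}.
HB.instance Definition _ := Choice.on structure_group.
HB.instance Definition _ := Quotient.on structure_group.
HB.instance Definition _ : EqQuotient _ sg_equiv_rel structure_group :=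
  EqQuotient.on structure_group.

Implicit Types g h : structure_group.

Definition sg_pi (a : sg_term S) : structure_group := \pi a.

Lemma sg_piP a b : sg_pi a = sg_pi b <-> sg_equiv a b.
Proof.
split; first by move=> /eqmodP/asboolP.
by move=> ab; apply/eqmodP/asboolP.
Qed.

Lemma sg_pi_ind (P : structure_group -> Prop) :
  (forall a, P (sg_pi a)) -> forall g, P g.
Proof. by move=> H g; rewrite -[g]reprK; exact: H. Qed.

Lemma sg_repr a : sg_equiv (repr (sg_pi a)) a.
Proof. by apply/sg_piP; exact: reprK. Qed.

Definition sg_one : structure_group := sg_pi SgOne.
Definition sg_mul (g h : structure_group) : structure_group :=
  sg_pi (SgMul (repr g) (repr h)).
Definition sg_inv (g : structure_group) : structure_group :=
  sg_pi (SgInv (repr g)).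

Lemma sg_pi_mul a b : sg_mul (sg_pi a) (sg_pi b) = sg_pi (SgMul a b).
Proof. by apply/sg_piP/SgMulCongr; exact: sg_repr. Qed.
Lemma sg_pi_inv a : sg_inv (sg_pi a) = sg_pi (SgInv a).
Proof. by apply/sg_piP/SgInvCongr; exact: sg_repr. Qed.

Fact sg_mulA : associative sg_mul.
Proof.
elim/sg_pi_ind=> a; elim/sg_pi_ind=> b; elim/sg_pi_ind=> c.
by rewrite !sg_pi_mul; apply/sg_piP/SgMulA.
Qed.
Fact sg_mul1 : left_id sg_one sg_mul.
Proof. by elim/sg_pi_ind=> a; rewrite sg_pi_mul; apply/sg_piP/SgMul1. Qed.
Fact sg_mulr1 : right_id sg_one sg_mul.
Proof. by elim/sg_pi_ind=> a; rewrite sg_pi_mul; apply/sg_piP/SgMulr1. Qed.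
Fact sg_mulV : left_inverse sg_one sg_inv sg_mul.
Proof.
by elim/sg_pi_ind=> a; rewrite sg_pi_inv sg_pi_mul; apply/sg_piP/SgMulV.
Qed.
Fact sg_mulrV : right_inverse sg_one sg_inv sg_mul.
Proof.
by elim/sg_pi_ind=> a; rewrite sg_pi_inv sg_pi_mul; apply/sg_piP/SgMulrV.
Qed.

HB.instance Definition _ :=
  isGroup.Build structure_group sg_mulA sg_mul1 sg_mulr1 sg_mulV sg_mulrV.

Definition sg_gen (x : S) : structure_group := sg_pi (SgGen x).

Lemma sg_piM a b : (sg_pi (SgMul a b) = sg_pi a * sg_pi b)%g.
Proof. by rewrite -sg_pi_mul. Qed.
Lemma sg_piV a : (sg_pi (SgInv a) = (sg_pi a)^-1)%g.
Proof. by rewrite -sg_pi_inv. Qed.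

Lemma sg_genM x y : (sg_gen x * sg_gen y = sg_gen (sigma x y) * sg_gen (gamma y x))%g.
Proof. by rewrite -!sg_piM; apply/sg_piP/SgRel/ybe_mapE. Qed.

Lemma sg_ind (P : structure_group -> Prop) :
  P 1%g -> (forall g x, P g -> P (g * sg_gen x)%g) ->
  (forall g x, P g -> P (g * (sg_gen x)^-1)%g) -> forall g, P g.
Proof.
move=> P1 PM PV; elim/sg_pi_ind => a.
suff H : forall g, P g -> P (g * sg_pi a)%g /\ P (g * (sg_pi a)^-1)%g.
  by have [] := H _ P1; rewrite mul1g.
elim: a => [|x|a IHa b IHb|a IHa] g Pg.
- by rewrite -[sg_pi _]/(1%g : structure_group) invg1 mulg1.
- by split; [exact: PM|exact: PV].
- rewrite sg_piM invgM !mulgA; split.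
    by apply: (IHb _ _).1; apply: (IHa _ _).1.
  by apply: (IHa _ _).2; apply: (IHb _ _).2.
- by rewrite sg_piV invgK; case: (IHa _ Pg).
Qed.

(* The action of [structure_group] on [S] extending [x |-> sigma x]. *)
Fixpoint sg_term_act (a : sg_term S) : sym S :=
  match a with
  | SgOne => 1%g
  | SgGen x => sigma x
  | SgMul a b => (sg_term_act a * sg_term_act b)%g
  | SgInv a => (sg_term_act a)^-1%g
  end.

Lemma sg_term_act_equiv a b : sg_equiv a b -> sg_term_act a = sg_term_act b.
Proof.
elim=> //= {a b}.
- by move=> b a c _ -> _ ->.
- by move=> a a' b b' _ -> _ ->.
- by move=> a a' _ ->.
- by move=> a b c; rewrite mulgA.
- by move=> a; rewrite mul1g.
- by move=> a; rewrite mulg1.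
- by move=> a; rewrite mulVg.
- by move=> a; rewrite mulgV.
- by move=> x y z t; rewrite ybe_mapE => -[<- <-]; rewrite ybe_sigmaM.
Qed.

Definition sg_act (g : structure_group) : sym S := sg_term_act (repr g).

Lemma sg_act_pi a : sg_act (sg_pi a) = sg_term_act a.
Proof. exact: sg_term_act_equiv (sg_repr a). Qed.

Lemma sg_act1 : sg_act 1%g = 1%g. Proof. exact: sg_act_pi. Qed.
Lemma sg_actM g h : sg_act (g * h)%g = (sg_act g * sg_act h)%g.
Proof.
elim/sg_pi_ind: g => a; elim/sg_pi_ind: h => b.
by rewrite -sg_piM !sg_act_pi.
Qed.
Lemma sg_actV g : sg_act (g^-1)%g = (sg_act g)^-1%g.
Proof. by elim/sg_pi_ind: g => a; rewrite -sg_piV !sg_act_pi. Qed.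
Lemma sg_act_gen x : sg_act (sg_gen x) = sigma x.
Proof. exact: sg_act_pi. Qed.

Definition fgact (f : sym S) : {freeg S} -> {freeg S} :=
  fglift (fun x => << f x >>).

Lemma fgactB f D E : fgact f (D - E) = fgact f D - fgact f E.
Proof. exact: lift_is_additive. Qed.
Lemma fgact0 f : fgact f 0 = 0.
Proof. by have := fgactB f 0 0; rewrite !subrr. Qed.
Lemma fgactN f D : fgact f (- D) = - fgact f D.
Proof. by rewrite -[- D]sub0r fgactB fgact0 sub0r. Qed.
Lemma fgactD f D E : fgact f (D + E) = fgact f D + fgact f E.
Proof. by rewrite -[E in LHS]opprK fgactB fgactN opprK. Qed.
Lemma fgactU f x : fgact f << x >> = << f x >>.
Proof. by rewrite /fgact liftU scale1r. Qed.

Lemma freeg_ind1 (P : {freeg S} -> Prop) :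
  P 0 -> (forall D x, P D -> P (D + << x >>)) ->
  (forall D x, P D -> P (D - << x >>)) -> forall D, P D.
Proof.
move=> P0 PD PB.
have PU (c : int) E x : P E -> P (E + << c *g x >>).
  move=> PE; elim: c => [|n IHn|n IHn].
  - by rewrite freegU0 addr0.
  - by rewrite -addn1 PoszD -freegUD addrA; exact: PD.
  - by rewrite -addn1 PoszD opprD -freegUD addrA -[<< - 1 *g x >>]freegUN; exact: PB.
move=> D; rewrite -[D]freeg_sumE; elim: (dom D) => [|x s IHs].
  by rewrite big_nil.
by rewrite big_cons addrC; exact: PU.
Qed.

Lemma fgact1 D : fgact 1%g D = D.
Proof.
elim/freeg_ind1: D => [|D x IH|D x IH]; first exact: fgact0.
  by rewrite fgactD fgactU IH.
by rewrite fgactB fgactU IH.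
Qed.

Lemma fgactM f f' D : fgact (f * f')%g D = fgact f (fgact f' D).
Proof.
elim/freeg_ind1: D => [|D x IH|D x IH]; first by rewrite !fgact0.
  by rewrite !fgactD !fgactU IH.
by rewrite !fgactB !fgactU IH.
Qed.

(* The bijective 1-cocycle extending [x |-> << x >>], along which the additive
   structure of the structure group is transported. *)
Fixpoint sg_term_cocycle (a : sg_term S) : {freeg S} :=
  match a with
  | SgOne => 0
  | SgGen x => << x >>
  | SgMul a b => sg_term_cocycle a + fgact (sg_term_act a) (sg_term_cocycle b)
  | SgInv a => - fgact (sg_term_act a)^-1%g (sg_term_cocycle a)
  end.

Lemma sg_term_cocycle_equiv a b :
  sg_equiv a b -> sg_term_cocycle a = sg_term_cocycle b.
Proof.
elim=> //= {a b}.
- by move=> b a c _ -> _ ->.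
- by move=> a a' b b' aa' -> _ ->; rewrite (sg_term_act_equiv aa').
- by move=> a a' aa' ->; rewrite (sg_term_act_equiv aa').
- by move=> a b c; rewrite fgactD fgactM addrA.
- by move=> a; rewrite fgact1 add0r.
- by move=> a; rewrite fgact0 addr0.
- by move=> a; rewrite addrC subrr.
- by move=> a; rewrite fgactN -fgactM mulgV fgact1 subrr.
- move=> x y z t; rewrite ybe_mapE => -[<- <-].
  by rewrite !fgactU ybe_sigmaK addrC.
Qed.

Definition sg_cocycle (g : structure_group) : {freeg S} :=
  sg_term_cocycle (repr g).

Lemma sg_cocycle_pi a : sg_cocycle (sg_pi a) = sg_term_cocycle a.
Proof. exact: sg_term_cocycle_equiv (sg_repr a). Qed.

Lemma sg_cocycle1 : sg_cocycle 1%g = 0. Proof. exact: sg_cocycle_pi. Qed.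
Lemma sg_cocycle_gen x : sg_cocycle (sg_gen x) = << x >>.
Proof. exact: sg_cocycle_pi. Qed.
Lemma sg_cocycleM g h :
  sg_cocycle (g * h)%g = sg_cocycle g + fgact (sg_act g) (sg_cocycle h).
Proof.
elim/sg_pi_ind: g => a; elim/sg_pi_ind: h => b.
by rewrite -sg_piM !sg_cocycle_pi sg_act_pi.
Qed.

(* [sg_add x g] and [sg_sub x g] are [g + x] and [g - x] in the additive
   structure to be defined. *)
Definition sg_add x g : structure_group :=
  (g * sg_gen ((sg_act g)^-1%g x))%g.

Definition sg_sub x g : structure_group :=
  (let y := (sg_act g)^-1%g x in g * (sg_gen ((gamma y)^-1%g y))^-1)%g.

Lemma ybe_diagK y : sigma ((gamma y)^-1%g y) y = (gamma y)^-1%g y.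
Proof.
set w := (gamma y)^-1%g y.
have e : gamma y w = y by rewrite symKV.
by have := ybe_gammaK w y; rewrite e => h; rewrite -[LHS](symVK (gamma y)) h.
Qed.

Lemma ybe_diagV (w : S) : let y := (sigma w)^-1%g w in (gamma y)^-1%g y = w.
Proof.
move=> y; have e : sigma w y = w by rewrite symKV.
have := ybe_sigmaK w y; rewrite e => e'.
have {}e' : gamma y w = y by rewrite -[LHS](symVK (sigma w)) e'.
by rewrite -[in RHS](symVK (gamma y) w) e'.
Qed.

Lemma sg_subK x g : sg_add x (sg_sub x g) = g.
Proof.
rewrite /sg_sub; set y := (sg_act g)^-1%g x.
rewrite /sg_add sg_actM sg_actV sg_act_gen invgM invgK symME -/y.
by rewrite ybe_diagK -mulgA mulVg mulg1.
Qed.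

Lemma sg_addK x g : sg_sub x (sg_add x g) = g.
Proof.
rewrite /sg_add; set y := (sg_act g)^-1%g x.
by rewrite /sg_sub sg_actM sg_act_gen invgM symME -/y ybe_diagV -mulgA mulgV mulg1.
Qed.

Lemma sg_add_comm x y g : sg_add x (sg_add y g) = sg_add y (sg_add x g).
Proof.
rewrite /sg_add !sg_actM !sg_act_gen !invgM !symME.
set u := (sg_act g)^-1%g y; set v := (sg_act g)^-1%g x.
rewrite -!mulgA; congr (_ * _)%g; rewrite sg_genM symKV; congr (_ * sg_gen _)%g.
apply: (canRL (symVK _)).
by have := ybe_sigmaK u ((sigma u)^-1%g v); rewrite symKV.
Qed.

Lemma sg_cocycle_add x g : sg_cocycle (sg_add x g) = sg_cocycle g + << x >>.
Proof. by rewrite sg_cocycleM sg_cocycle_gen fgactU symKV. Qed.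

Lemma sg_cocycle_sub x g : sg_cocycle (sg_sub x g) = sg_cocycle g - << x >>.
Proof. by rewrite -[in RHS](sg_subK x g) sg_cocycle_add addrK. Qed.

Lemma sg_cocycle_surj D : exists g, sg_cocycle g = D.
Proof.
elim/freeg_ind1: D => [|D x [g <-]|D x [g <-]].
- by exists 1%g; exact: sg_cocycle1.
- by exists (sg_add x g); exact: sg_cocycle_add.
- by exists (sg_sub x g); exact: sg_cocycle_sub.
Qed.

Definition sg_step (bx : bool * S) g :=
  if bx.1 then sg_sub bx.2 g else sg_add bx.2 g.

Lemma sg_stepC u v g : sg_step u (sg_step v g) = sg_step v (sg_step u g).
Proof.
have E1 x y h : sg_add x (sg_sub y h) = sg_sub y (sg_add x h).
  by rewrite -[LHS](sg_addK y) sg_add_comm sg_subK.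
case: u v => [[] x] [[] y]; rewrite /sg_step //=; last exact: sg_add_comm.
have e : g = sg_add x (sg_add y (sg_sub y (sg_sub x g))) by rewrite !sg_subK.
by rewrite [in LHS]e sg_add_comm !sg_addK.
Qed.

Lemma sg_stepK b x g : sg_step (~~ b, x) (sg_step (b, x) g) = g.
Proof. by case: b; rewrite /sg_step /= ?sg_subK ?sg_addK. Qed.

Definition sg_run (l : seq (bool * S)) g := foldr sg_step g l.

Definition fg_sum (l : seq (bool * S)) : {freeg S} :=
  \sum_(bx <- l) (<< (-1) ^+ bx.1 *g bx.2 >>).

Lemma sg_run_step l u g : sg_run l (sg_step u g) = sg_step u (sg_run l g).
Proof. by elim: l => //= v l ->; rewrite sg_stepC. Qed.

Lemma fg_sum_coeff b x l : (~~ b, x) \notin l ->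
  0 <= (-1) ^+ b * coeff x (fg_sum l) :> int.
Proof.
elim: l => [|[c y] l IHl]; first by rewrite /fg_sum big_nil coeff0 mulr0.
rewrite inE negb_or => /andP[ne nl].
rewrite /fg_sum big_cons coeffD coeffU /= mulrDr; apply: addr_ge0; last exact: IHl.
case: (eqVneq y x) ne => [->|_ _]; last by rewrite !mulr0.
by case: b c {IHl nl} => [] []; rewrite xpair_eqE eqxx.
Qed.

Lemma sg_run_sum0 l g : fg_sum l = 0 -> sg_run l g = g.
Proof.
have [n] := ubnP (size l); elim: n l => // n IHn [|[b x] l] //= ln l0.
have xl : (~~ b, x) \in l.
  apply/negPn/negP => /fg_sum_coeff; move: l0; rewrite /fg_sum big_cons.
  move=> /(congr1 (coeff x)); rewrite coeffD coeff0 coeffU eqxx mulr1 /=.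
  move=> /eqP; rewrite addrC addr_eq0 => /eqP ->.
  by case: (b).
move: ln l0; case/splitPr: xl => l1 l2 ln l0.
rewrite /sg_run foldr_cat /= -/(sg_run _ _) -/(sg_run _ _) sg_run_step.
rewrite -{1}[b]negbK sg_stepK /sg_run -foldr_cat; apply: IHn.
  by move: ln; rewrite !size_cat /= addnS !ltnS; exact: ltnW.
move: l0; rewrite /fg_sum big_cons !big_cat big_cons /= addrCA.
have -> : (-1) ^+ (~~ b) = - (-1) ^+ b :> int by case: (b).
by rewrite -freegUN addNKr.
Qed.

Lemma sg_run_cat l1 l2 g : sg_run (l1 ++ l2) g = sg_run l1 (sg_run l2 g).
Proof. exact: foldr_cat. Qed.

Lemma fg_sum_cat l1 l2 : fg_sum (l1 ++ l2) = fg_sum l1 + fg_sum l2.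
Proof. exact: big_cat. Qed.

Lemma fg_sum_seq1 b x : fg_sum [:: (b, x)] = if b then - << x >> else << x >>.
Proof. by rewrite /fg_sum big_seq1 freegUN; case: b; rewrite /= ?expr1. Qed.

Lemma sg_mul_genE g x : (g * sg_gen x)%g = sg_add (sg_act g x) g.
Proof. by rewrite /sg_add symVK. Qed.

Lemma sg_runP g :
  (exists2 l, sg_run l 1%g = g & fg_sum l = sg_cocycle g) /\
  (exists2 l, sg_run l g = 1%g & fg_sum l = - sg_cocycle g).
Proof.
elim/sg_ind: g => [|g x [[l lg ls] [l' lg' ls']]|g x [[l lg ls] [l' lg' ls']]].
- by rewrite sg_cocycle1 oppr0; split; exists [::] => //; rewrite /fg_sum big_nil.
- rewrite sg_mul_genE sg_cocycle_add; set y := sg_act g x.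
  split; [exists ((false, y) :: l)|exists (l' ++ [:: (true, y)])].
  + by rewrite /= lg.
  + by rewrite -cat1s fg_sum_cat fg_sum_seq1 ls addrC.
  + by rewrite sg_run_cat /= /sg_step /= sg_addK.
  + by rewrite fg_sum_cat fg_sum_seq1 ls' opprD.
- set h := (g * _)%g; set y := sg_act h x.
  have gh : g = sg_add y h by rewrite -sg_mul_genE /h -mulgA mulVg mulg1.
  have hg : h = sg_sub y g by rewrite gh sg_addK.
  have ch : sg_cocycle h = sg_cocycle g - << y >>.
    by rewrite hg sg_cocycle_sub.
  split; [exists ((true, y) :: l)|exists (l' ++ [:: (false, y)])].
  + by rewrite /= lg hg.
  + by rewrite -cat1s fg_sum_cat fg_sum_seq1 ls ch addrC.
  + by rewrite sg_run_cat /= /sg_step /= -gh.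
  + by rewrite fg_sum_cat fg_sum_seq1 ls' ch opprB addrC.
Qed.

Lemma sg_cocycle_inj : injective sg_cocycle.
Proof.
move=> g h gh.
have [[l lg ls] _] := sg_runP g; have [_ [l' lh ls']] := sg_runP h.
rewrite -lg -lh -sg_run_cat; apply: sg_run_sum0.
by rewrite fg_sum_cat ls ls' gh subrr.
Qed.

Definition sg_of_freeg (D : {freeg S}) : structure_group :=
  projT1 (cid (sg_cocycle_surj D)).

Lemma sg_of_freegK : cancel sg_of_freeg sg_cocycle.
Proof. by move=> D; rewrite /sg_of_freeg; case: cid. Qed.

Lemma sg_cocycleK : cancel sg_cocycle sg_of_freeg.
Proof. by move=> g; apply: sg_cocycle_inj; rewrite sg_of_freegK. Qed.

Definition sg_zero : structure_group := sg_of_freeg 0.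
Definition sg_opp (g : structure_group) : structure_group :=
  sg_of_freeg (- sg_cocycle g).
Definition sg_plus (g h : structure_group) : structure_group :=
  sg_of_freeg (sg_cocycle g + sg_cocycle h).

Fact sg_plusA : associative sg_plus.
Proof. by move=> g h k; rewrite /sg_plus !sg_of_freegK addrA. Qed.
Fact sg_plusC : commutative sg_plus.
Proof. by move=> g h; rewrite /sg_plus addrC. Qed.
Fact sg_plus0 : left_id sg_zero sg_plus.
Proof. by move=> g; rewrite /sg_plus sg_of_freegK add0r sg_cocycleK. Qed.
Fact sg_plusN : left_inverse sg_zero sg_opp sg_plus.
Proof. by move=> g; rewrite /sg_plus sg_of_freegK addNr. Qed.

HB.instance Definition _ :=
  GRing.isZmodule.Build structure_group sg_plusA sg_plusC sg_plus0 sg_plusN.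

Lemma sg_cocycleD g h : sg_cocycle (g + h) = sg_cocycle g + sg_cocycle h.
Proof. exact: sg_of_freegK. Qed.

Fact sg_braceMD (a b c : structure_group) :
  (a * (b + c))%g + a = (a * b)%g + (a * c)%g.
Proof.
apply: sg_cocycle_inj; rewrite !(sg_cocycleD, sg_cocycleM) fgactD.
by rewrite -!addrA [sg_cocycle a + fgact _ _]addrC.
Qed.

HB.instance Definition _ :=
  Group_Zmodule_isLeftBrace.Build structure_group sg_braceMD.

(* Together with [sg_lambda_gen] and [sg_act_gen], this characterizes the natural
   left brace structure: additively free abelian on [S], with
   [lambda (sg_gen x) (sg_gen y) = sg_gen (sigma x y)]. *)
Lemma sg_additive_free :
  bijective sg_cocycle /\ (forall g h, sg_cocycle (g + h) = sg_cocycle g + sg_cocycle h)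
    /\ (forall x, sg_cocycle (sg_gen x) = << x >>).
Proof.
split; first by exists sg_of_freeg; [exact: sg_cocycleK|exact: sg_of_freegK].
by split; [exact: sg_cocycleD|exact: sg_cocycle_gen].
Qed.

Lemma sg_cocycle_lambda g h :
  sg_cocycle (lambda g h) = fgact (sg_act g) (sg_cocycle h).
Proof.
apply: (addrI (sg_cocycle g)).
by rewrite -sg_cocycleD -braceM_lambda sg_cocycleM.
Qed.

Lemma sg_lambda_gen g x : lambda g (sg_gen x) = sg_gen (sg_act g x).
Proof.
by apply: sg_cocycle_inj; rewrite sg_cocycle_lambda !sg_cocycle_gen fgactU.
Qed.

Lemma sg_act_eq_lambda g g' : sg_act g = sg_act g' -> lambda g = lambda g'.
Proof.
by move=> e; apply: funext => h; apply: sg_cocycle_inj; rewrite !sg_cocycle_lambda e.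
Qed.

Lemma sg_gen_inj : injective sg_gen.
Proof.
move=> x y /(congr1 sg_cocycle); rewrite !sg_cocycle_gen.
move=> /(congr1 (coeff y)); rewrite !coeffU eqxx mulr1 mul1r.
by case: eqP.
Qed.

Lemma sg_act_kerP g : sg_act g = 1%g <-> socle structure_group g.
Proof.
split=> [e|e].
  by rewrite /socle /= (sg_act_eq_lambda (g' := 1%g)) ?sg_act1 //; apply: funext => h; rewrite lambda1.
apply: symP => x; apply: sg_gen_inj.
by rewrite -sg_lambda_gen; have -> : lambda g = id by exact: e.
Qed.

End StructureGroup.

Inductive in_perm_group (S : ybe_solution) : sym S -> Prop :=
  | PermGroupGen x : in_perm_group (sigma x)
  | PermGroupOne : in_perm_group 1%g
  | PermGroupMul f g :
      in_perm_group f -> in_perm_group g -> in_perm_group (f * g)%g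
  | PermGroupInv f : in_perm_group f -> in_perm_group (f^-1)%g.

Record perm_group (S : ybe_solution) := PermGroup {
  perm_group_val :> sym S;
  _ : `[< in_perm_group perm_group_val >]
}.

HB.instance Definition _ (S : ybe_solution) :=
  [isSub for @perm_group_val S].
HB.instance Definition _ (S : ybe_solution) :=
  [Choice of perm_group S by <:].

Section PermGroup.
Variable S : ybe_solution.
Implicit Types p q : perm_group S.
Implicit Types g h : structure_group S.

Lemma perm_groupP p : in_perm_group p.
Proof. by case: p => f /= /asboolP. Qed.

Definition perm_group_of (f : sym S) (Hf : in_perm_group f) : perm_group S :=
  PermGroup (asboolT Hf).

Definition pg_one : perm_group S := perm_group_of (@PermGroupOne S).
Definition pg_mul p q : perm_group S :=
  perm_group_of (PermGroupMul (perm_groupP p) (perm_groupP q)).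
Definition pg_inv p : perm_group S :=
  perm_group_of (PermGroupInv (perm_groupP p)).

Fact pg_mulA : associative pg_mul.
Proof. by move=> p q s; apply: val_inj; rewrite /= mulgA. Qed.
Fact pg_mul1 : left_id pg_one pg_mul.
Proof. by move=> p; apply: val_inj; rewrite /= mul1g. Qed.
Fact pg_mulr1 : right_id pg_one pg_mul.
Proof. by move=> p; apply: val_inj; rewrite /= mulg1. Qed.
Fact pg_mulV : left_inverse pg_one pg_inv pg_mul.
Proof. by move=> p; apply: val_inj; rewrite /= mulVg. Qed.
Fact pg_mulrV : right_inverse pg_one pg_inv pg_mul.
Proof. by move=> p; apply: val_inj; rewrite /= mulgV. Qed.

HB.instance Definition _ :=
  isGroup.Build (perm_group S) pg_mulA pg_mul1 pg_mulr1 pg_mulV pg_mulrV.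

Lemma in_perm_group_act g : in_perm_group (sg_act g).
Proof.
elim/sg_ind: g => [|g x IH|g x IH]; first by rewrite sg_act1; exact: PermGroupOne.
  by rewrite sg_actM sg_act_gen; apply: PermGroupMul => //; exact: PermGroupGen.
rewrite sg_actM sg_actV sg_act_gen; apply: PermGroupMul => //.
exact/PermGroupInv/PermGroupGen.
Qed.

Definition sg_phi g : perm_group S := perm_group_of (in_perm_group_act g).

Lemma sg_phi_gen x : perm_group_val (sg_phi (sg_gen x)) = sigma x.
Proof. exact: sg_act_gen. Qed.
Lemma sg_phi1 : sg_phi 1%g = 1%g.
Proof. by apply: val_inj; exact: sg_act1. Qed.
Lemma sg_phiM g h : sg_phi (g * h)%g = (sg_phi g * sg_phi h)%g.
Proof. by apply: val_inj; exact: sg_actM. Qed.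
Lemma sg_phiV g : sg_phi (g^-1)%g = (sg_phi g)^-1%g.
Proof. by apply: val_inj; exact: sg_actV. Qed.

Lemma sg_phi_surj p : exists g, sg_phi g = p.
Proof.
suff [g gp] : exists g, sg_act g = p by exists g; exact: val_inj.
elim: (perm_groupP p) => [x||f f' _ [g <-] _ [h <-]|f _ [g <-]].
- by exists (sg_gen x); rewrite sg_act_gen.
- by exists 1%g; rewrite sg_act1.
- by exists (g * h)%g; rewrite sg_actM.
- by exists (g^-1)%g; rewrite sg_actV.
Qed.

Lemma sg_phi_kerP g : sg_phi g = 1%g <-> socle (structure_group S) g.
Proof.
rewrite -sg_act_kerP; split=> [/(congr1 val)//|e].
exact: val_inj.
Qed.

Lemma sg_phi_lambda g g' : sg_phi g = sg_phi g' -> lambda g = lambda g'.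
Proof. by move=> /(congr1 val); exact: sg_act_eq_lambda. Qed.

Lemma lambda_socle g z :
  socle (structure_group S) z -> lambda g z = (g * z * g^-1)%g.
Proof.
move=> /sg_phi_kerP kz; set w := (g * z * g^-1)%g.
have kw : sg_phi w = 1%g by rewrite !sg_phiM kz sg_phiV mulg1 mulgV.
have lw : lambda w g = g.
  by rewrite (@sg_phi_lambda w 1%g) ?sg_phi1 // lambda1.
have e : (g * z)%g = w + g.
  by rewrite -[g in RHS]lw -braceM_lambda /w -mulgA mulVg mulg1.
by rewrite /lambda e addrK.
Qed.

Lemma sg_phi_lambda_eq k h h' :
  sg_phi h = sg_phi h' -> sg_phi (lambda k h) = sg_phi (lambda k h').
Proof.
move=> e; have [z -> kz] : exists2 z, h' = (h * z)%g & sg_phi z = 1%g.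
  exists (h^-1 * h')%g; first by rewrite mulgA mulgV mul1g.
  by rewrite sg_phiM sg_phiV e mulVg.
have sz : socle (structure_group S) z by apply/sg_phi_kerP.
have kl m : sg_phi (lambda m z) = 1%g.
  by rewrite (lambda_socle _ sz) !sg_phiM kz sg_phiV mulg1 mulgV.
by rewrite braceM_lambda lambdaD braceD_lambda -!lambdaM sg_phiM kl mulg1.
Qed.

Lemma sg_phi_addE g h g' h' : sg_phi g = sg_phi g' -> sg_phi h = sg_phi h' ->
  sg_phi (g + h) = sg_phi (g' + h').
Proof.
move=> eg eh; rewrite !braceD_lambda !sg_phiM eg.
rewrite (@sg_phi_lambda g^-1%g g'^-1%g) ?sg_phiV ?eg //.
by congr (_ * _)%g; exact: sg_phi_lambda_eq.
Qed.

Definition sg_lift p : structure_group S := projT1 (cid (sg_phi_surj p)).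

Lemma sg_liftK : cancel sg_lift sg_phi.
Proof. by move=> p; rewrite /sg_lift; case: cid. Qed.

(* [sg_phi] is onto with kernel the socle of [structure_group S]; the addition
   of the quotient brace is transported along it through representatives, the
   choice of which is irrelevant by [sg_phi_addE]. *)
Definition pg_zero : perm_group S := sg_phi 0.
Definition pg_opp p : perm_group S := sg_phi (- sg_lift p).
Definition pg_plus p q : perm_group S := sg_phi (sg_lift p + sg_lift q).

Fact pg_plusE g h : pg_plus (sg_phi g) (sg_phi h) = sg_phi (g + h).
Proof. by apply: sg_phi_addE; rewrite sg_liftK. Qed.

Fact pg_plusA : associative pg_plus.
Proof.
move=> p q s; rewrite -[p]sg_liftK -[q]sg_liftK -[s]sg_liftK.
by rewrite !pg_plusE addrA.
Qed.
Fact pg_plusC : commutative pg_plus.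
Proof. by move=> p q; rewrite /pg_plus addrC. Qed.
Fact pg_plus0 : left_id pg_zero pg_plus.
Proof. by move=> p; rewrite -[p]sg_liftK pg_plusE add0r. Qed.
Fact pg_plusN : left_inverse pg_zero pg_opp pg_plus.
Proof. by move=> p; rewrite -[p in X in pg_plus _ X]sg_liftK pg_plusE addNr. Qed.

HB.instance Definition _ :=
  GRing.isZmodule.Build (perm_group S) pg_plusA pg_plusC pg_plus0 pg_plusN.

Lemma sg_phiD g h : sg_phi (g + h) = sg_phi g + sg_phi h.
Proof. by rewrite -pg_plusE. Qed.

Fact pg_braceMD p q s : (p * (q + s))%g + p = (p * q)%g + (p * s)%g.
Proof.
rewrite -[p]sg_liftK -[q]sg_liftK -[s]sg_liftK.
by rewrite -!(sg_phiD, sg_phiM) braceMD.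
Qed.

HB.instance Definition _ :=
  Group_Zmodule_isLeftBrace.Build (perm_group S) pg_braceMD.

End PermGroup.

(* Main.v *)
Require Import Defs.
From mathcomp Require Import all_boot all_order all_algebra.
From mathcomp Require Import boolp classical_sets.

Local Open Scope classical_set_scope.

(** Every permutation [p] in the permutation group is the image [sg_phi g] of
    some [g] in the structure group, and as a permutation [p] is the restriction
    of [lambda g] to the generators. As [sg_phi] is a homomorphism of braces, it
    carries this action to [lambda p] acting on the permutations [sigma x], so
    that [lambda p (sigma x) = sigma (p x)] ([lambda_sigma]). If [p] lies in
    the socle, then [sigma (p x) = sigma x], and irretractability gives
    [p x = x] for all [x]. *)

Lemma sg_phi_lambdaE (S : ybe_solution) (g h : structure_group S) :
  sg_phi (lambda g h) = lambda (sg_phi g) (sg_phi h).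
Proof.
apply: (GRing.addrI (sg_phi g)).
by rewrite -sg_phiD -!braceM_lambda sg_phiM.
Qed.

(** The brace structure of the permutation group is defined through arbitrary
    lifts to the structure group; this equation computes its [lambda] on the
    generators in terms of the permutations alone. *)
Lemma lambda_sigma (S : ybe_solution) (p : perm_group S) (x : S) :
  lambda p (sg_phi (sg_gen x)) = sg_phi (sg_gen (p x)).
Proof.
have [g <-] := sg_phi_surj p.
by rewrite -sg_phi_lambdaE sg_lambda_gen.
Qed.

Theorem lemma2p1 (S : ybe_solution) (irrS : irretractable S) :
  socle (perm_group S) = [set 1%g].
Proof.
apply/seteqP; split=> p; last first.
  by move=> ->; apply: funext => q; rewrite lambda1.
move=> socp; apply/val_inj/symP => x; apply: irrS.
by rewrite -!sg_phi_gen -lambda_sigma (socp : lambda p = id).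
Qed.
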